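(* Let $N\in\mathbb{N}$ and let $0\le\lambda_1\le\lambda_2\le\dots\le\lambda_N$ be real numbers. Suppose that a $C^*$-algebra $A$ has irreducible representations of dimensions $n_1<n_2<\dots<n_N<\infty$ (and possibly of some other dimensions too). Then there exists $a\in A$ such that $\|a\|_{\mathbb{M}_{n_k}}=\lambda_k$ for all $1\le k\le N$. In addition, $a$ can be chosen such that $\|a\|=\|a\|_{\mathbb{M}_{n_N}}$.
   Context: For a $C^*$-algebra $A$ having an irreducible representation of dimension at most $n\in\mathbb{N}$, and $a\in A$, $$\|a\|_{\mathbb{M}_n}=\sup\{\|\pi(a)\|\;:\;\pi:A\to\mathbb{M}_n \text{ a } *\text{-homomorphism}\},$$ where $\mathbb{M}_n$ is the $C^*$-algebra of complex $n\times n$ matrices and the $*$-homomorphisms are not required to be non-degenerate. Equivalently, the supremum is over all irreducible representations of $A$ of dimension at most $n$. *)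

(* Defs.v *)
From HB Require Import structures.
From mathcomp Require Import all_boot all_order all_algebra.
From mathcomp Require Import all_classical all_reals all_analysis.
From mathcomp Require Import complex.

Set Implicit Arguments.
Unset Strict Implicit.
Unset Printing Implicit Defensive.

Import Order.TTheory GRing.Theory Num.Theory numFieldNormedType.Exports.

Local Open Scope classical_set_scope.
Local Open Scope ring_scope.
Local Open Scope complex_scope.

(* C*-algebras are not assumed to be unital (nor nonzero), so the product
   cannot be inherited from the ring structures of the library. The norm of a
   normed module over R[i] takes its values in R[i] and is real and >= 0. *)
HB.mixin Record CompleteNormedModule_isCStarAlgebra (R : realType) A
    of CompleteNormedModule R[i] A := {
  cmul : A -> A -> A;
  cadj : A -> A;
  cmulA : associative cmul;
  cmulDl : left_distributive cmul +%R;
  cmulDr : right_distributive cmul +%R;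
  cmulZl : forall (k : R[i]) (x y : A), cmul (k *: x) y = k *: cmul x y;
  cmulZr : forall (k : R[i]) (x y : A), cmul x (k *: y) = k *: cmul x y;
  cadjK : involutive cadj;
  cadjD : {morph cadj : x y / x + y};
  cadjZ : forall (k : R[i]) (x : A), cadj (k *: x) = k^* *: cadj x;
  cadjM : forall x y : A, cadj (cmul x y) = cmul (cadj y) (cadj x);
  cnormM : forall x y : A, `|cmul x y| <= `|x| * `|y|;
  cnorm_adjM : forall x : A, `|cmul (cadj x) x| = `|x| ^+ 2
}.

#[short(type="cstarAlgType")]
HB.structure Definition CStarAlgebra (R : realType) :=
  {A of CompleteNormedModule_isCStarAlgebra R A & CompleteNormedModule R[i] A}.

Section Representations.
Context {R : realType}.

Definition adjmx n (M : 'M[R[i]]_n) : 'M[R[i]]_n :=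
  (map_mx (fun z : R[i] => z^*) M)^T.

Definition l2norm n (v : 'cV[R[i]]_n) : R :=
  Num.sqrt (\sum_(i < n) complex.Re `|v i 0| ^+ 2).

(* The C*-norm of matrices; the canonical norm of the library on matrices is
   the max norm instead. *)
Definition opnorm n (M : 'M[R[i]]_n) : R :=
  sup [set l2norm (M *m v) | v in [set v : 'cV[R[i]]_n | l2norm v <= 1]].

Record star_hom (A : cstarAlgType R) n (pi : A -> 'M[R[i]]_n) : Prop :=
  StarHom {
    star_hom_linear : linear pi;
    star_homM : forall x y : A, pi (cmul x y) = pi x *m pi y;
    star_hom_adj : forall x : A, pi (cadj x) = adjmx (pi x)
  }.

(* The zero representation on a one-dimensional space is not irreducible;
   irr_rep_neq0 also forces 0 < n. *)
Record irr_rep (A : cstarAlgType R) n (pi : A -> 'M[R[i]]_n) : Prop :=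
  IrrRep {
    irr_rep_star_hom : star_hom pi;
    irr_rep_neq0 : exists a : A, pi a != 0;
    irr_rep_invariant : forall U : {vspace 'cV[R[i]]_n},
      (forall (a : A) (v : 'cV[R[i]]_n), v \in U -> pi a *m v \in U) ->
      U = 0%VS \/ U = fullv
  }.

Definition has_irr_rep (A : cstarAlgType R) (n : nat) : Prop :=
  exists pi : A -> 'M[R[i]]_n, irr_rep pi.

(* The set is nonempty (zero homomorphism) and bounded above by the norm of a,
   *-homomorphisms being contractive, so that sup is a genuine supremum. *)
Definition mxnorm (A : cstarAlgType R) (n : nat) (a : A) : R :=
  sup [set r : R | exists2 pi : A -> 'M[R[i]]_n, star_hom pi & r = opnorm (pi a)].

End Representations.

(* Main.v *)
Require Import Defs.
From mathcomp Require Import all_boot all_order all_algebra.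
From mathcomp Require Import all_classical all_reals all_analysis.
From mathcomp Require Import complex.
From mathcomp Require Import perm spectral ring lra.
Import Order.TTheory GRing.Theory Num.Theory numFieldNormedType.Exports.
Local Open Scope ring_scope.
Local Open Scope complex_scope.

Set Implicit Arguments.
Unset Strict Implicit.
Unset Printing Implicit Defensive.

(** Two constructions carry the proof.

    Separation. A matrix algebra of size m < n satisfies polynomial
    identities that fail in size n. If pi is an irreducible representation of
    dimension n, its image contains all matrix units (irr_rep_delta,
    Burnside's theorem), and a Capelli polynomial evaluated at lifts of the
    n^2 matrix units is an element b with pi b != 0 that every representation
    of dimension m < n kills, because n^2 matrices of size m are linearly
    dependent (irr_rep_separating).

    Cutting off. Let f t = 2 t / (1 + t^2), which is at most 1 in absolute
    value, reaches 1 at t = 1 and is increasing on [0, 1]. For h self-adjoint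
    with Cayley transform u = (1 + i h) / (1 - i h), f(h) is the imaginary part
    of u; as u is unitary, f(h) has norm at most 1, however large the norm of h
    is. On the other hand the matrix norm of f(h) in dimension m is f of that
    of h, as long as the latter is at most 1 (cutoff). The rational function f
    thus replaces the functional calculus of t |-> min(t, 1): only inverses
    are used, and these come from a fixed-point argument.

    The norms are then prescribed one dimension at a time
    (mxnorms_prescribed). To get norms mu_1 <= ... <= mu_k with mu_k > 0 and
    total norm at most mu_k, take by induction a self-adjoint x of norm at
    most 1 whose first k - 1 matrix norms are the preimages under f of
    mu_j / mu_k. Adding c times a self-adjoint separating element b for the
    dimension n_k does not alter these; by the intermediate value theorem some
    c makes the norm of x + c b in dimension n_k equal to 1: it is at most 1
    at c = 0 because the norm of x is, and it is unbounded in c. Then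
    mu_k f(x + c b) is as required. The last clause of the theorem follows,
    since representations are contractive (star_hom_contractive) and so
    lambda_N, a matrix norm of the element, bounds its norm from below. *)

Local Notation "x ** y" := (cmul x y) (at level 40, left associativity).

(** * Real norms and fixed points *)

Section RealNorm.
Context {R : realType}.
Implicit Types (X : normedModType R[i]).

(** The norm of a module over R[i] is an element of R[i]; [nrm] is the same
    number in R, where linear arithmetic is available. *)
Definition nrm X (x : X) : R := complex.Re `|x|.

Lemma norm_nrmE X (x : X) : `|x| = (nrm x)%:C.
Proof. by rewrite /nrm RRe_real ?normr_real. Qed.

Lemma nrm_ge0 X (x : X) : 0 <= nrm x.
Proof. by rewrite -ler0c -norm_nrmE. Qed.

Lemma nrm0 X : nrm (0 : X) = 0.
Proof. by rewrite /nrm normr0. Qed.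

Lemma nrm_eq0 X (x : X) : nrm x = 0 -> x = 0.
Proof. by move=> x0; apply/normr0_eq0; rewrite norm_nrmE x0. Qed.

Lemma nrmN X (x : X) : nrm (- x) = nrm x.
Proof. by rewrite /nrm normrN. Qed.

Lemma nrmD X (x y : X) : nrm (x + y) <= nrm x + nrm y.
Proof. by rewrite -lecR rmorphD /= -!norm_nrmE ler_normD. Qed.

Lemma nrmB X (x y : X) : nrm (x - y) <= nrm x + nrm y.
Proof. by rewrite -[nrm y]nrmN nrmD. Qed.

Lemma nrmZ X (k : R[i]) (x : X) : nrm (k *: x) = complex.Re `|k| * nrm x.
Proof.
apply: complexI; rewrite -norm_nrmE normrZ norm_nrmE rmorphM /=.
by rewrite RRe_real ?normr_real.
Qed.

Lemma Re_normC (k : R) : complex.Re `|k%:C| = `|k|.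
Proof. by rewrite normc_def /= expr0n addr0 sqrtr_sqr. Qed.

Lemma nrmZR X (k : R) (x : X) : nrm (k%:C *: x) = `|k| * nrm x.
Proof. by rewrite nrmZ Re_normC. Qed.

Lemma nrmZi X (x : X) : nrm ('i *: x) = nrm x.
Proof. by rewrite nrmZ normc_def /= expr0n expr1n add0r sqrtr1 mul1r. Qed.

Lemma real_scaleVK X (t : R) (x : X) : t != 0 -> t^-1%:C *: (t%:C *: x) = x.
Proof. by move=> t0; rewrite scalerA -rmorphM /= mulVf // rmorph1 scale1r. Qed.

Lemma real_scaleKV X (t : R) (x : X) : t != 0 -> t%:C *: (t^-1%:C *: x) = x.
Proof. by move=> t0; rewrite scalerA -rmorphM /= mulfV // rmorph1 scale1r. Qed.

End RealNorm.

Section FixedPoint.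
Local Open Scope classical_set_scope.
Local Open Scope ring_scope.
Context {R : realType} {X : completeNormedModType R[i]}.

(** Banach's theorem on a closed ball, for modules over R[i] and real Lipschitz
    constants: the iterates of 0 form a Cauchy sequence. *)
Lemma contraction_fixpoint (T : X -> X) (rho q : R) :
  0 <= rho -> 0 <= q -> q < 1 ->
  (forall x, nrm x <= rho -> nrm (T x) <= rho) ->
  (forall x y, nrm x <= rho -> nrm y <= rho ->
     nrm (T x - T y) <= q * nrm (x - y)) ->
  exists2 x, nrm x <= rho & T x = x.
Proof.
move=> rho0 q0 q1 Tball Tlip.
pose u k := iter k T (0 : X).
have ub k : nrm (u k) <= rho.
  by elim: k => [|k IH]; rewrite /u /= ?nrm0 //; exact: Tball.
have ulip k m : nrm (u k - u (k + m)%N) <= q ^+ k * (2 * rho).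
  elim: k m => [|k IH] m.
    rewrite expr0 mul1r; apply: le_trans (nrmB _ _) _.
    by have := ub 0%N; have := ub (0 + m)%N; lra.
  rewrite addSn /= exprS -mulrA; apply: le_trans (Tlip _ _ (ub _) (ub _)) _.
  exact: ler_wpM2l.
have qsmall (e : R) : 0 < e -> exists k, q ^+ k * (2 * rho) < e.
  move=> e0; have e1 : 0 < e / (2 * rho + 1) by apply: divr_gt0 => //; lra.
  have q1' : `|q| < 1 by rewrite ger0_norm.
  have /cvgrPdist_lt /(_ _ e1) [k _ /(_ k (leqnn k))] := cvg_expr q1'.
  rewrite /= sub0r normrN ger0_norm ?exprn_ge0 // => qk.
  exists k; apply: le_lt_trans (_ : q ^+ k * (2 * rho + 1) < _).
    by apply: ler_wpM2l; [exact: exprn_ge0|lra].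
  by rewrite -ltr_pdivlMr //; lra.
have ucauchy : cauchy (u @ \oo).
  apply: cauchy_exP => e; rewrite ltcE /= => /andP[/eqP Ime e0].
  have [k qk] := qsmall _ e0.
  exists (u k); exists k => // m /= km.
  rewrite -ball_normE /= norm_nrmE ltcE /= Ime eqxx /=.
  by rewrite -(subnKC km); apply: le_lt_trans qk.
have /cauchy_cvgP/cvg_ex [l ul] := ucauchy.
have lim_u (e : R) : 0 < e -> exists k, nrm (l - u k) < e /\ nrm (l - u k.+1) < e.
  rewrite -ltcR => e0.
  have /cvgrPdist_lt /(_ _ e0) [k _ uk] := ul.
  exists k; split; rewrite -ltcR -norm_nrmE.
    exact: (uk k (leqnn k)).
  exact: (uk k.+1 (leqnSn k)).
have lrho : nrm l <= rho.
  apply/ler_addgt0Pr => e e0; have [k [lk _]] := lim_u _ e0.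
  rewrite -(subrK (u k) l); apply: le_trans (nrmD _ _) _.
  by have := ub k; lra.
exists l => //; apply/eqP; rewrite -subr_eq0; apply/eqP/nrm_eq0/eqP.
rewrite eq_le nrm_ge0 andbT; apply/ler_addgt0Pr => e e0.
have /lim_u [k [lk lk1]] : 0 < e / 2 by lra.
have -> : T l - l = (T l - T (u k)) - (l - u k.+1).
  by rewrite opprB addrA subrK.
apply: le_trans (nrmB _ _) _.
have := Tlip _ _ lrho (ub k).
have : q * nrm (l - u k) <= 1 * nrm (l - u k) by apply: ler_wpM2r (nrm_ge0 _) _ _ _; lra.
by lra.
Qed.
End FixedPoint.

Section Affine.
Context {R : realType} {X : completeNormedModType R[i]}.

(** A Neumann series: u + K preserves the ball of radius nrm u / (1 - q). *)
Lemma affine_fixpoint (K : X -> X) (u : X) (q : R) :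
  0 <= q -> q < 1 -> {morph K : x y / x - y} ->
  (forall x, nrm (K x) <= q * nrm x) ->
  exists x, x = u + K x.
Proof.
move=> q0 q1 KB Kq.
have u0 := nrm_ge0 u.
have [|x xr|x y _ _|x _ xE] :=
  @contraction_fixpoint _ _ (fun x => u + K x) (nrm u / (1 - q)) q _ q0 q1.
- by apply: divr_ge0 => //; lra.
- apply: le_trans (nrmD _ _) _; have -> : nrm u / (1 - q) = nrm u + q * (nrm u / (1 - q)).
    by field; rewrite lt0r_neq0 //; lra.
  by rewrite lerD2l; apply: le_trans (Kq _) _; apply: ler_wpM2l.
- by rewrite addrAC opprD addrA subrr sub0r addrC -KB.
- by exists x.
Qed.

End Affine.

(** * The Cayley transform in a C*-algebra *)

Section CStar.
Context {R : realType} {A : cstarAlgType R}.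
Implicit Types (x y z a b d h k : A) (t : R).

Lemma cmul0x x : 0 ** x = 0.
Proof. by apply: (addrI (0 ** x)); rewrite -cmulDl !addr0. Qed.

Lemma cmulx0 x : x ** 0 = 0.
Proof. by apply: (addrI (x ** 0)); rewrite -cmulDr !addr0. Qed.

Lemma cmulNx x y : (- x) ** y = - (x ** y).
Proof. by apply/eqP; rewrite -addr_eq0 -cmulDl addNr cmul0x. Qed.

Lemma cmulxN x y : x ** (- y) = - (x ** y).
Proof. by apply/eqP; rewrite -addr_eq0 -cmulDr addNr cmulx0. Qed.

Lemma cmulBl x y z : (x - y) ** z = x ** z - y ** z.
Proof. by rewrite cmulDl cmulNx. Qed.

Lemma cmulBr x y z : x ** (y - z) = x ** y - x ** z.
Proof. by rewrite cmulDr cmulxN. Qed.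

(** The axiom conjugates in the closed field R[i]; [conjc] is the convertible form on
    which the componentwise computations run. *)
Lemma cadj_scale (c : R[i]) x : cadj (c *: x) = conjc c *: cadj x.
Proof. exact: cadjZ. Qed.

Lemma cadjN x : cadj (- x) = - cadj x.
Proof. by rewrite -[- x]scaleN1r cadjZ rmorphN rmorph1 scaleN1r. Qed.

Lemma cadj0 : cadj (0 : A) = 0.
Proof. by rewrite -(scale0r (0 : A)) cadjZ rmorph0 !scale0r. Qed.

Lemma cadjB x y : cadj (x - y) = cadj x - cadj y.
Proof. by rewrite cadjD cadjN. Qed.

Lemma cadjZR t x : cadj (t%:C *: x) = t%:C *: cadj x.
Proof. by rewrite cadj_scale conjc_real. Qed.

Lemma nrmM x y : nrm (x ** y) <= nrm x * nrm y.
Proof. by rewrite -lecR rmorphM /= -!norm_nrmE cnormM. Qed.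

Lemma nrm_adjM x : nrm (cadj x ** x) = nrm x ^+ 2.
Proof. by apply: complexI; rewrite rmorphXn /= -!norm_nrmE cnorm_adjM. Qed.

(** From the C*-identity, the square of nrm y is at most nrm (cadj y) * nrm y. *)
Lemma nrm_adj x : nrm (cadj x) = nrm x.
Proof.
suff le_adj y : nrm y <= nrm (cadj y).
  by apply/eqP; rewrite eq_le le_adj -{2}[x]cadjK le_adj.
have := nrm_ge0 y; rewrite le_eqVlt => /predU1P[<-|y0]; first exact: nrm_ge0.
by rewrite -(ler_pM2r y0) -expr2 -nrm_adjM nrmM.
Qed.

Lemma real_scaleD (t s : R) x : (t + s)%:C *: x = t%:C *: x + s%:C *: x.
Proof. by rewrite rmorphD scalerDl. Qed.

Lemma half_double x : (2^-1)%:C *: (x + x) = x.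
Proof.
rewrite scalerDr -real_scaleD (_ : 2^-1 + 2^-1 = 1); last by field.
by rewrite rmorph1 scale1r.
Qed.

(** A square root of 1 - b in an algebra that may lack a unit: the equation says
    (1 - s)^2 = 1 - b. It is a fixed-point equation s = (b + s^2) / 2 for a
    contraction of the ball of radius nrm b, and s is self-adjoint because
    its adjoint is another fixed point in that ball. *)
Lemma one_sub_sqrt b : cadj b = b -> nrm b < 1 ->
  exists2 s, cadj s = s & s + s = b + s ** s.
Proof.
move=> bsa b1; have b0 := nrm_ge0 b.
pose T x := (2^-1)%:C *: (b + x ** x).
have Tlip x y : nrm x <= nrm b -> nrm y <= nrm b ->
    nrm (T x - T y) <= nrm b * nrm (x - y).
  move=> xb yb; rewrite /T -scalerBr nrmZR ger0_norm; last by rewrite invr_ge0.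
  have -> : b + x ** x - (b + y ** y) = x ** (x - y) + (x - y) ** y.
    by rewrite cmulBr cmulBl addrA subrK opprD addrACA subrr add0r.
  have := nrmD (x ** (x - y)) ((x - y) ** y).
  have := nrmM x (x - y); have := nrmM (x - y) y; have := nrm_ge0 (x - y).
  by nra.
have [x xb|s sb Ts] := contraction_fixpoint b0 b0 b1 _ Tlip.
  have := nrmD b (x ** x); have := nrmM x x; have := nrm_ge0 x.
  rewrite /T nrmZR ger0_norm; last by rewrite invr_ge0.
  by nra.
exists s; last by rewrite -{1 2}Ts -scalerDr half_double.
(* The adjoint of s is a fixed point of T in the same ball, so it is s. *)
have Ts' : T (cadj s) = cadj s.
  by rewrite -{2}Ts /T cadjZR cadjD cadjM bsa.
apply/eqP; rewrite -subr_eq0; apply/eqP/nrm_eq0.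
have := Tlip (cadj s) s; rewrite Ts Ts' nrm_adj => /(_ sb sb).
by have := nrm_ge0 (cadj s - s); nra.
Qed.

(** The hypothesis says that 1 + d is an isometry, in terms that make sense
    without a unit: with v = 1 + d and v' its adjoint, v' v = 1. By the
    C*-identity, v then acts isometrically on A. *)
Lemma cayley_isometric d : d + cadj d + cadj d ** d = 0 ->
  forall x, nrm (x + d ** x) = nrm x.
Proof.
move=> dU x; apply/eqP; rewrite -(@eqrXn2 _ 2) ?nrm_ge0 // -!nrm_adjM.
have -> : cadj (x + d ** x) ** (x + d ** x)
    = cadj x ** x + cadj x ** ((d + cadj d + cadj d ** d) ** x).
  by rewrite cadjD cadjM !(cmulDl, cmulDr) !cmulA !addrA.
by rewrite dU cmul0x cmulx0 addr0.
Qed.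

(** With v = 1 + d, x' and v' the adjoints of x and v, and y = v' x, the norm of y
    squared is that of x' (v y), hence at most nrm x * nrm y. *)
Lemma cayley_adj_contractive d : d + cadj d + cadj d ** d = 0 ->
  forall x, nrm (x + cadj d ** x) <= nrm x.
Proof.
move=> dU x.
have : cadj (x + cadj d ** x) = cadj x + cadj x ** d by rewrite cadjD cadjM cadjK.
move: (x + _) => y yE.
have := nrm_ge0 y; rewrite le_eqVlt => /predU1P[<-|y0]; first exact: nrm_ge0.
rewrite -(ler_pM2r y0) -expr2 -nrm_adjM yE cmulDl -cmulA -cmulDr.
by apply: le_trans (nrmM _ _) _; rewrite nrm_adj cayley_isometric.
Qed.

(** The difference e of 1 + d and its adjoint acts on A with norm at most 2; applied
    to the adjoint of e, this bounds the norm of e by the C*-identity. *)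
Lemma cayley_skew_bound d : d + cadj d + cadj d ** d = 0 ->
  nrm (d - cadj d) <= 2.
Proof.
move=> dU; set e := d - cadj d.
have := nrm_ge0 e; rewrite le_eqVlt => /predU1P[<-|e0]; first by [].
rewrite -(ler_pM2r e0) -expr2 -[in leLHS]nrm_adj -nrm_adjM cadjK.
have -> : e ** cadj e = (cadj e + d ** cadj e) - (cadj e + cadj d ** cadj e).
  by rewrite opprD addrACA subrr add0r -cmulBl.
apply: le_trans (nrmB _ _) _; rewrite cayley_isometric //.
by have := cayley_adj_contractive dU (cadj e); rewrite nrm_adj; lra.
Qed.

(** The equation on d is (t - k) (1 + d) = t + k, so that 1 + d is the Cayley
    transform of the skew-adjoint element k / t. *)
Lemma cayley_unitary k t d : 0 < t -> cadj k = - k ->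
  t%:C *: d = k + k + k ** d -> d + cadj d + cadj d ** d = 0.
Proof.
move=> t0 kN td.
have tC0 : t%:C != 0 by rewrite -[0]/(0%:C) (inj_eq (@complexI _)) gt_eqF.
have tdN : t%:C *: cadj d = - (k + k + cadj d ** k).
  by rewrite -cadjZR td !cadjD cadjM kN cmulxN !opprD.
have half2 (x : A) : x + x = 0 -> x = 0.
  rewrite -mulr2n => /eqP; rewrite -scaler_nat scaler_eq0 pnatr_eq0 /=.
  by move/eqP.
apply/eqP; rewrite -(inj_eq (scalerI tC0)) scaler0; apply/eqP/half2.
(* The double of cadj d ** d is split so that each equation on d is used once. *)
have tdd : t%:C *: (cadj d ** d) + t%:C *: (cadj d ** d)
    = (cadj d ** k - k ** d) + (cadj d ** k - k ** d).
  rewrite -{1}cmulZr -cmulZl td tdN cmulNx !(cmulDl, cmulDr) cmulA.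
  by rewrite opprD addrACA subrr addr0 opprD addrACA.
rewrite !scalerDr td tdN addrACA tdd addrACA.
have -> : k + k + k ** d - (k + k + cadj d ** k) + (cadj d ** k - k ** d) = 0.
  rewrite opprD [X in X + _]addrACA subrr add0r.
  by rewrite -[cadj d ** k - _]opprB subrr.
by rewrite addr0.
Qed.

(** For T larger than the norm of k, the inverse of T - k is a Neumann series. The
    Cayley transform being isometric, that inverse is S = (2 + D) / (2 T) of
    norm at most 1 / T, so t - k = (T - k) - (T - t) is again invertible for
    every t in ]0, T], as T - t < T. *)
Lemma cayley_exists k t : 0 < t -> cadj k = - k ->
  exists d, t%:C *: d = k + k + k ** d.
Proof.
move=> t0 kN.
have k0 := nrm_ge0 k.
pose T := Num.max t (nrm k + 1).
have T0 : 0 < T by rewrite lt_max t0.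
have CK (s : R) (x : A) : 0 < s -> s%:C *: (s^-1%:C *: x) = x.
  by move=> s0; rewrite real_scaleKV ?gt_eqF.
have CV (s : R) (x : A) : 0 < s -> nrm (s^-1%:C *: x) = s^-1 * nrm x.
  by move=> s0; rewrite nrmZR ger0_norm // invr_ge0 ltW.
(* The Cayley transform exists at T, where nrm k / T < 1. *)
have [D DE] : exists D, T%:C *: D = k + k + k ** D.
  have [||x y|x|D DE] := @affine_fixpoint _ _ (fun x => T^-1%:C *: (k ** x))
      (T^-1%:C *: (k + k)) (T^-1 * nrm k).
  - by rewrite mulr_ge0 // invr_ge0 ltW.
  - by rewrite ltr_pdivrMl // mulr1 lt_max ltrDl ltr01 orbT.
  - by rewrite cmulBr scalerBr.
  - by rewrite CV // -mulrA ler_pM2l ?invr_gt0 // nrmM.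
  by exists D; rewrite {1}DE -scalerDr CK.
have DU := cayley_unitary T0 kN DE.
pose S x := (T + T)^-1%:C *: (x + x + D ** x).
have TT0 : 0 < T + T by rewrite addr_gt0.
have SE x : T%:C *: S x - k ** S x = x.
  rewrite /S scalerA mulrC -scalerA cmulZr -scalerBr.
  apply: etrans (CK (T + T) x TT0); rewrite scalerA mulrC -scalerA; congr (_ *: _).
  rewrite !scalerDr -cmulZl DE !(cmulDl, cmulDr) cmulA real_scaleD.
  by rewrite addrK.
have SB : {morph S : x y / x - y}.
  move=> x y; rewrite /S -scalerBr cmulBr; congr (_ *: _).
  by rewrite opprD [RHS]addrACA opprD [in RHS](addrACA x).
have Sn x : nrm (S x) <= T^-1 * nrm x.
  rewrite /S CV // -addrA.
  have := nrmD x (x + D ** x); rewrite cayley_isometric // => xx.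
  apply: (@le_trans _ _ ((T + T)^-1 * (nrm x + nrm x))).
    by rewrite ler_pM2l ?invr_gt0.
  by rewrite le_eqVlt; apply/orP; left; apply/eqP; field; lra.
have tT : t <= T by rewrite le_max lexx.
have [||x y|x|d dE] := @affine_fixpoint _ _ (fun x => (T - t)%:C *: S x)
    (S (k + k)) (T^-1 * (T - t)).
- by apply: mulr_ge0; rewrite ?invr_ge0 ?subr_ge0 // ltW.
- by rewrite ltr_pdivrMl //; lra.
- by rewrite SB scalerBr.
- rewrite nrmZR ger0_norm ?subr_ge0 // [T^-1 * _]mulrC -mulrA.
  by apply: ler_wpM2l (Sn x); rewrite subr_ge0.
exists d.
have SZ (s : R) x : s%:C *: S x = S (s%:C *: x).
  rewrite /S scalerA mulrC -scalerA; congr (_ *: _).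
  by rewrite !scalerDr cmulZr.
have SD x y : S x + S y = S (x + y).
  by rewrite /S -scalerDr cmulDr; congr (_ *: _); rewrite addrACA (addrACA x).
have := SE (k + k + (T - t)%:C *: d).
rewrite -SD -SZ -dE rmorphB /= scalerBl addrCA => /addrI kd.
by rewrite -[k ** d]opprK kd opprB addrC subrK.
Qed.

(** Here 1 + w is the inverse of 1 - i h, and - i (w - cadj w) = 2 h / (1 + h^2) is
    the imaginary part of the Cayley transform 1 + 2 w. *)
Lemma cayley_imaginary_part h : cadj h = h ->
  exists w, w = 'i *: h + 'i *: (h ** w) /\ nrm (w - cadj w) <= 1.
Proof.
move=> hsa.
have kN : cadj ('i *: h) = - ('i *: h).
  rewrite cadj_scale hsa -scaleNr; congr (_ *: _).
  by apply/eqP; rewrite eq_complex /= oppr0 !eqxx.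
have [d] := cayley_exists ltr01 kN.
rewrite scale1r => dE.
have dU : d + cadj d + cadj d ** d = 0.
  by apply: (cayley_unitary ltr01 kN); rewrite scale1r.
exists ((2^-1)%:C *: d); split.
  rewrite {1}dE scalerDr half_double cmulZr cmulZl; congr (_ + _).
  by rewrite !scalerA mulrC.
rewrite cadjZR -scalerBr nrmZR ger0_norm ?invr_ge0 //.
by have := cayley_skew_bound dU; lra.
Qed.

End CStar.

(** * Hermitian geometry of column vectors *)

Section Hilbert.
Context {R : realType}.
Local Notation C := R[i].

(** The adjoint of a rectangular matrix, convertible to [adjmx] on square ones. *)
Definition hconj m n (M : 'M[C]_(m, n)) : 'M[C]_(n, m) := (map_mx conjc M)^T.

Lemma hconjM m n p (M : 'M[C]_(m, n)) (N : 'M[C]_(n, p)) :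
  hconj (M *m N) = hconj N *m hconj M.
Proof. by rewrite /hconj map_mxM trmx_mul. Qed.

Lemma hconjK m n : cancel (@hconj m n) (@hconj n m).
Proof. by move=> M; apply/matrixP=> i j; rewrite !mxE conjcK. Qed.

Lemma hconjD m n (M N : 'M[C]_(m, n)) : hconj (M + N) = hconj M + hconj N.
Proof. by rewrite /hconj map_mxD linearD. Qed.

Lemma hconjZ m n (k : C) (M : 'M[C]_(m, n)) : hconj (k *: M) = conjc k *: hconj M.
Proof. by apply/matrixP=> i j; rewrite !mxE rmorphM. Qed.

(** The real part of the inner product: it determines the same norm, and being real
    bilinear and symmetric it is enough for all estimates below. *)
Definition rip n (u v : 'cV[C]_n) : R := complex.Re ((hconj u *m v) 0 0).

Lemma ReD (x y : C) : complex.Re (x + y) = complex.Re x + complex.Re y.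
Proof. by case: x; case: y. Qed.

Lemma ReZ (t : R) (x : C) : complex.Re (t%:C * x) = t * complex.Re x.
Proof. by case: x => a b /=; rewrite mul0r subr0. Qed.

Lemma ReJ (x : C) : complex.Re (conjc x) = complex.Re x.
Proof. by case: x. Qed.

Lemma ripC n (u v : 'cV[C]_n) : rip u v = rip v u.
Proof. by rewrite /rip -[v in LHS]hconjK -hconjM !mxE ReJ. Qed.

Lemma ripDr n (u v w : 'cV[C]_n) : rip u (v + w) = rip u v + rip u w.
Proof. by rewrite /rip mulmxDr mxE ReD. Qed.

Lemma ripDl n (u v w : 'cV[C]_n) : rip (u + v) w = rip u w + rip v w.
Proof. by rewrite ripC ripDr !(ripC w). Qed.

Lemma ripZr n (t : R) (u v : 'cV[C]_n) : rip u (t%:C *: v) = t * rip u v.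
Proof. by rewrite /rip -scalemxAr mxE ReZ. Qed.

Lemma ripZl n (t : R) (u v : 'cV[C]_n) : rip (t%:C *: u) v = t * rip u v.
Proof. by rewrite ripC ripZr ripC. Qed.

Lemma ripNr n (u v : 'cV[C]_n) : rip u (- v) = - rip u v.
Proof. by rewrite -scaleN1r -[-1](rmorphN1 (real_complex R)) ripZr mulN1r. Qed.

Lemma ripNl n (u v : 'cV[C]_n) : rip (- u) v = - rip u v.
Proof. by rewrite ripC ripNr ripC. Qed.

Lemma rip_adj n (M : 'M[C]_n) (u v : 'cV[C]_n) :
  rip (M *m u) v = rip u (adjmx M *m v).
Proof. by rewrite /rip hconjM -mulmxA. Qed.

Lemma ripvv n (v : 'cV[C]_n) : rip v v = \sum_(i < n) complex.Re `|v i 0| ^+ 2.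
Proof.
rewrite /rip mxE (big_morph (@complex.Re R) ReD (erefl : complex.Re 0 = 0)).
apply: eq_bigr => i _; rewrite !mxE normc_def /= sqr_sqrtr; last first.
  by apply: addr_ge0; apply: sqr_ge0.
by case: (v i 0) => a b /=; ring.
Qed.

Lemma ripvv_ge0 n (v : 'cV[C]_n) : 0 <= rip v v.
Proof. by rewrite ripvv; apply: sumr_ge0 => i _; apply: sqr_ge0. Qed.

Lemma sqr_l2norm n (v : 'cV[C]_n) : l2norm v ^+ 2 = rip v v.
Proof. by rewrite /l2norm -ripvv sqr_sqrtr // ripvv_ge0. Qed.

Lemma l2norm_ge0 n (v : 'cV[C]_n) : 0 <= l2norm v.
Proof. exact: sqrtr_ge0. Qed.

Lemma l2norm_eq0 n (v : 'cV[C]_n) : l2norm v = 0 -> v = 0.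
Proof.
move=> v0; have : rip v v = 0 by rewrite -sqr_l2norm v0 expr0n.
rewrite ripvv => /eqP; rewrite psumr_eq0 => [|i _]; last exact: sqr_ge0.
move=> /allP vi0; apply/matrixP => i j; rewrite ord1 mxE.
have := vi0 i (mem_index_enum i); rewrite sqrf_eq0 => /eqP.
by move=> vi; apply/normr0_eq0; rewrite -[LHS]RRe_real ?normr_real // vi.
Qed.

Lemma l2norm0 n : l2norm (0 : 'cV[C]_n) = 0.
Proof.
by apply/eqP; rewrite -sqrf_eq0 sqr_l2norm /rip mulmx0 mxE.
Qed.

Lemma l2normZ n (t : R) (v : 'cV[C]_n) : l2norm (t%:C *: v) = `|t| * l2norm v.
Proof.
apply/eqP; rewrite -(@eqrXn2 _ 2) ?mulr_ge0 ?l2norm_ge0 //.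
by rewrite exprMn !sqr_l2norm ripZl ripZr real_normK ?num_real // mulrA.
Qed.

Lemma rip_le n (u v : 'cV[C]_n) : rip u v <= l2norm u * l2norm v.
Proof.
have [u0|u0] := eqVneq (l2norm u) 0.
  by rewrite u0 mul0r (l2norm_eq0 u0) -[0]/(0 : 'cV_n) /rip /hconj map_mx0 trmx0 mul0mx mxE.
have [v0|v0] := eqVneq (l2norm v) 0.
  by rewrite v0 mulr0 (l2norm_eq0 v0) /rip mulmx0 mxE.
have := ripvv_ge0 ((l2norm v)%:C *: u - (l2norm u)%:C *: v).
rewrite !(ripDl, ripDr, ripNl, ripNr, ripZl, ripZr) -!sqr_l2norm (ripC v u).
have ug : 0 < l2norm u by rewrite lt_def u0 l2norm_ge0.
have vg : 0 < l2norm v by rewrite lt_def v0 l2norm_ge0.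
have uv : 0 < l2norm u * l2norm v by rewrite mulr_gt0.
move: (l2norm u) (l2norm v) (rip u v) ug vg uv => a b r ug vg uv h.
rewrite -(ler_pM2l uv); nra.
Qed.

Lemma l2normD n (u v : 'cV[C]_n) : l2norm (u + v) <= l2norm u + l2norm v.
Proof.
have u0 := l2norm_ge0 u; have v0 := l2norm_ge0 v.
rewrite -(@ler_pXn2r _ 2) ?nnegrE ?addr_ge0 ?l2norm_ge0 //.
rewrite sqr_l2norm !(ripDl, ripDr) -!sqr_l2norm (ripC v u).
by have := rip_le u v; nra.
Qed.

Lemma opnorm_le n (M : 'M[C]_n) (c : R) : 0 <= c ->
  (forall v, l2norm (M *m v) <= c * l2norm v) -> opnorm M <= c.
Proof.
move=> c0 Mc; apply: ge_sup.
  by exists (l2norm (M *m 0)); exists 0 => //=; rewrite l2norm0.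
move=> _ [v /= v1 <-]; apply: le_trans (Mc v) _.
by rewrite -[leRHS]mulr1 ler_wpM2l.
Qed.

(** Some bound c has to be known for the supremum defining [opnorm] to be meaningful;
    for images of representations, contractivity provides it. *)
Lemma l2norm_mulmx_le n (M : 'M[C]_n) (c : R) :
  (forall v, l2norm (M *m v) <= c * l2norm v) ->
  forall v, l2norm (M *m v) <= opnorm M * l2norm v.
Proof.
move=> Mc v.
have [v0|v0] := eqVneq (l2norm v) 0.
  by rewrite (l2norm_eq0 v0) mulmx0 l2norm0 mulr0.
have vg : 0 < l2norm v by rewrite lt_def v0 l2norm_ge0.
rewrite -ler_pdivrMr // mulrC.
have iv : 0 <= (l2norm v)^-1 by rewrite invr_ge0 l2norm_ge0.
apply: ub_le_sup.
  exists (Num.max c 0) => _ [w /= w1 <-]; apply: le_trans (Mc w) _.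
  have : c <= Num.max c 0 /\ 0 <= Num.max c 0 by rewrite !le_max !lexx orbT.
  by have := l2norm_ge0 w; nra.
exists ((l2norm v)^-1%:C *: v).
  by rewrite /= l2normZ ger0_norm // mulVf.
by rewrite -scalemxAr l2normZ ger0_norm.
Qed.

End Hilbert.

(** * Representations are contractive *)

Section StarHom.
Context {R : realType} {A : cstarAlgType R}.

Section OneHom.
Variables (n : nat) (pi : A -> 'M[R[i]]_n).
Hypothesis piH : star_hom pi.

Lemma star_homD x y : pi (x + y) = pi x + pi y.
Proof. by have := star_hom_linear piH 1 x y; rewrite !scale1r. Qed.

Lemma star_hom0 : pi 0 = 0.
Proof. by apply: (addrI (pi 0)); rewrite -star_homD !addr0. Qed.

Lemma star_homZ k x : pi (k *: x) = k *: pi x.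
Proof. by have := star_hom_linear piH k x 0; rewrite star_hom0 !addr0. Qed.

Lemma star_homN x : pi (- x) = - pi x.
Proof. by rewrite -[- x]scaleN1r star_homZ scaleN1r. Qed.

Lemma star_homB x y : pi (x - y) = pi x - pi y.
Proof. by rewrite star_homD star_homN. Qed.

Lemma star_hom_rip a (u v : 'cV_n) : rip (pi a *m u) v = rip u (pi (cadj a) *m v).
Proof. by rewrite rip_adj (star_hom_adj piH). Qed.

(** For t > nrm a, the element b = cadj a ** a / t^2 has norm less than 1, so 1 - b is the
    square of some self-adjoint 1 - s. Hence the matrix 1 - pi b is
    nonnegative, which means that the norm of pi a *m v is at most t times
    that of v. *)
Lemma star_hom_contractive a (v : 'cV_n) :
  l2norm (pi a *m v) <= nrm a * l2norm v.
Proof.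
have a0 := nrm_ge0 a; have v0 := l2norm_ge0 v.
suff pit (t : R) : nrm a < t -> l2norm (pi a *m v) <= t * l2norm v.
  apply/ler_addgt0Pr => e e0.
  have d0 : 0 < e / (l2norm v + 1) by apply: divr_gt0; lra.
  apply: le_trans (pit (nrm a + e / (l2norm v + 1)) _) _; first by lra.
  rewrite mulrDl lerD2l mulrAC ler_pdivrMr; last by lra.
  by rewrite ler_pM2l //; lra.
move=> at_; have t0 : 0 < t by lra.
pose b := (t^-1 ^+ 2)%:C *: (cadj a ** a).
have bsa : cadj b = b by rewrite /b cadjZR cadjM cadjK.
have b1 : nrm b < 1.
  rewrite nrmZR nrm_adjM ger0_norm ?exprn_ge0 ?invr_ge0 ?ltW //.
  rewrite -exprMn expr_lt1 //; last by rewrite mulr_ge0 // invr_ge0 ltW.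
  by rewrite ltr_pdivrMl // mulr1.
have [s ssa ss] := one_sub_sqrt bsa b1.
have t1 : 0 < t^-1 by rewrite invr_gt0.
(* The three terms of 0 <= |v - S v|^2 with S = pi s, knowing 2 S = pi b + S^2. *)
have bE : rip v (pi b *m v) = (t^-1 * l2norm (pi a *m v)) ^+ 2.
  rewrite /b star_homZ -scalemxAl ripZr (star_homM piH) -mulmxA -star_hom_rip.
  by rewrite -sqr_l2norm exprMn.
have sE : rip v (pi (s ** s) *m v) = rip (pi s *m v) (pi s *m v).
  by rewrite star_hom_rip ssa (star_homM piH) mulmxA.
have : rip v (pi (s + s) *m v) = rip v (pi (b + s ** s) *m v) by rewrite ss.
rewrite !star_homD !mulmxDl !ripDr bE sE => bss.
have := ripvv_ge0 (v - pi s *m v).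
rewrite !(ripDl, ripDr, ripNl, ripNr) (ripC (pi s *m v) v) -[rip v v]sqr_l2norm.
move=> h; suff : (t^-1 * l2norm (pi a *m v)) ^+ 2 <= l2norm v ^+ 2.
  rewrite ler_pXn2r ?nnegrE ?l2norm_ge0 // ?ler_pdivrMl //.
  by rewrite mulr_ge0 ?l2norm_ge0 // ltW.
move: bss h; move: (rip v (pi s *m v)) (rip (pi s *m v) (pi s *m v)) => r q.
move: (_ ^+ 2) (_ ^+ 2) => x y; lra.
Qed.

End OneHom.

Section MxNorm.
Context {n : nat}.
Implicit Types (a b : A) (c t : R).

Lemma star_hom_zero : star_hom (fun _ : A => 0 : 'M[R[i]]_n).
Proof.
split=> [k x y|x y|x]; rewrite ?scaler0 ?addr0 ?mulmx0 //.
by rewrite /adjmx map_mx0 trmx0.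
Qed.

Lemma mxnorm_le a c : 0 <= c ->
  (forall (pi : A -> 'M[R[i]]_n), star_hom pi ->
     forall v, l2norm (pi a *m v) <= c * l2norm v) ->
  mxnorm n a <= c.
Proof.
move=> c0 ac; apply: ge_sup.
  by exists (opnorm (0 : 'M[R[i]]_n)); exists (fun=> 0) => //; exact: star_hom_zero.
by move=> _ [pi piH ->]; apply: opnorm_le => //; exact: ac.
Qed.

(** Together with [mxnorm_le], this characterizes [mxnorm n a] as the least
    nonnegative constant bounding all the matrices pi a. *)
Lemma l2norm_le_mxnorm (pi : A -> 'M[R[i]]_n) a : star_hom pi ->
  forall v, l2norm (pi a *m v) <= mxnorm n a * l2norm v.
Proof.
move=> piH v; apply: le_trans (l2norm_mulmx_le (star_hom_contractive piH a) v) _.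
apply: ler_wpM2r (l2norm_ge0 v) _ _ _; apply: ub_le_sup; last by exists pi.
exists (nrm a) => _ [rho rhoH ->]; apply: opnorm_le (nrm_ge0 a) _.
exact: star_hom_contractive.
Qed.

Lemma mxnorm_ge0 a : 0 <= mxnorm n a.
Proof.
apply: le_trans (_ : opnorm (0 : 'M[R[i]]_n) <= _).
  apply: ub_le_sup; last by exists 0; rewrite /= ?mul0mx l2norm0.
  by exists 0 => _ [v _ <-]; rewrite mul0mx l2norm0.
apply: ub_le_sup; last by exists (fun=> 0) => //; exact: star_hom_zero.
exists (nrm a) => _ [rho rhoH ->]; apply: opnorm_le (nrm_ge0 a) _.
exact: star_hom_contractive.
Qed.

Lemma mxnorm_le_nrm a : mxnorm n a <= nrm a.
Proof. by apply: mxnorm_le (nrm_ge0 a) _ => pi piH; exact: star_hom_contractive. Qed.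

Lemma mxnormD a b : mxnorm n (a + b) <= mxnorm n a + mxnorm n b.
Proof.
apply: mxnorm_le => [|pi piH v]; first by rewrite addr_ge0 ?mxnorm_ge0.
rewrite star_homD // mulmxDl mulrDl; apply: le_trans (l2normD _ _) _.
by apply: lerD; exact: l2norm_le_mxnorm.
Qed.

Lemma mxnormZ_le t a : mxnorm n (t%:C *: a) <= `|t| * mxnorm n a.
Proof.
apply: mxnorm_le => [|pi piH v]; first by rewrite mulr_ge0 ?mxnorm_ge0.
by rewrite star_homZ // -scalemxAl l2normZ -mulrA ler_wpM2l // l2norm_le_mxnorm.
Qed.

Lemma mxnormZ t a : 0 < t -> mxnorm n (t%:C *: a) = t * mxnorm n a.
Proof.
move=> t0; apply/eqP; rewrite eq_le.
have := mxnormZ_le t a; rewrite (gtr0_norm t0) => -> /=.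
rewrite -ler_pdivlMl //.
have t1 : 0 < t^-1 by rewrite invr_gt0.
by have := mxnormZ_le t^-1 (t%:C *: a); rewrite (gtr0_norm t1) real_scaleVK ?gt_eqF.
Qed.

Lemma eq_mxnorm a b : (forall (pi : A -> 'M[R[i]]_n), star_hom pi -> pi a = pi b) ->
  mxnorm n a = mxnorm n b.
Proof.
move=> ab; apply/eqP; rewrite eq_le.
by apply/andP; split; apply: mxnorm_le (mxnorm_ge0 _) _ => pi piH v;
  rewrite (ab, =^~ ab) //; exact: l2norm_le_mxnorm.
Qed.

Lemma mxnorm0 : mxnorm n (0 : A) = 0.
Proof.
by apply/eqP; rewrite eq_le mxnorm_ge0 andbT -(nrm0 A) mxnorm_le_nrm.
Qed.

End MxNorm.
End StarHom.

(** * Cutting off the norm with the Cayley transform *)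

Section CayleyMatrix.
Context {R : realType} {n : nat}.
Implicit Types (H W M : 'M[R[i]]_n) (y v : 'cV[R[i]]_n).

Lemma hconj1 : hconj (1%:M : 'M[R[i]]_n) = 1%:M.
Proof. by apply/matrixP=> i j; rewrite !mxE eq_sym rmorph_nat. Qed.

(** Under a representation, [cayley_imaginary_part] becomes an identity between
    matrices: P = 1 - i H has the two-sided inverse X = 1 + W, and
    1 + H^2 is the product of P and its adjoint, in either order. *)
Lemma cayley_mx_imaginary H W : adjmx H = H -> W = 'i *: H + 'i *: (H *m W) ->
  (- 'i *: (W - adjmx W)) *m (1%:M + H *m H) = H + H /\
  exists G, (1%:M + H *m H) *m G = 1%:M.
Proof.
move=> Hsa WE.
pose P := 1%:M - 'i *: H; pose Q := 1%:M + 'i *: H; pose X := 1%:M + W.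
have PX : P *m X = 1%:M.
  by rewrite /P /X mulmxDr mulmx1 mulmxBl mul1mx -scalemxAl {1}WE addrK subrK.
have XP : X *m P = 1%:M by exact: mulmx1C.
have adjP : hconj P = Q.
  rewrite /P /Q hconjD hconj1 -scaleNr hconjZ -[hconj H]/(adjmx H) Hsa.
  congr (_ + _ *: _).
  by apply/eqP; rewrite eq_complex /= oppr0 opprK !eqxx.
have QX : Q *m hconj X = 1%:M by rewrite -adjP -hconjM XP hconj1.
have XQ : hconj X *m Q = 1%:M by exact: mulmx1C.
have ii : 'i * 'i = -1 :> R[i] by rewrite -expr2 sqr_i.
have PQ : P *m Q = 1%:M + H *m H.
  rewrite /P /Q mulmxDr mulmx1 mulmxBl mul1mx -scalemxAl -scalemxAr scalerA ii.
  by rewrite scaleN1r opprK addrA subrK.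
have QP : Q *m P = 1%:M + H *m H.
  rewrite /P /Q mulmxBr mulmx1 mulmxDl mul1mx -scalemxAl -scalemxAr scalerA ii.
  by rewrite scaleN1r opprD opprK addrA addrK.
split; last first.
  by exists (X *m hconj X); rewrite -QP -mulmxA (mulmxA P) PX mul1mx QX.
have -> : W - adjmx W = X - hconj X.
  by rewrite /X hconjD hconj1 -[adjmx W]/(hconj W) opprD addrACA subrr add0r.
rewrite -scalemxAl mulmxBl -{1}PQ -QP !mulmxA XP XQ !mul1mx /P /Q.
rewrite opprB addrC addrA subrK.
by rewrite -scalerDr scalerA mulNr ii opprK scale1r.
Qed.

(** Multiplied by a^2, the difference of the two sides is
    (tau^2 a^2 - b^2) (a^2 - tau^2 b^2) + tau^2 ((a c)^2 - b^4), where each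
    term is nonnegative; tau <= 1 serves for the second factor. *)
Lemma real_resolvent_le (a b c tau : R) : 0 <= a -> 0 <= b -> 0 <= c ->
  0 <= tau -> tau <= 1 -> b <= tau * a -> b ^+ 2 <= a * c ->
  (1 + tau ^+ 2) ^+ 2 * b ^+ 2 <= tau ^+ 2 * (a ^+ 2 + 2 * b ^+ 2 + c ^+ 2).
Proof.
move=> a0 b0 c0 tau0 tau1 ba b2ac.
have [aE|an0] := eqVneq a 0.
  have -> : b = 0 by apply/eqP; rewrite eq_le b0 andbT; rewrite aE mulr0 in ba.
  by rewrite expr0n mulr0 mulr_ge0 ?exprn_ge0 // ?addr_ge0 ?mulr_ge0 ?exprn_ge0.
have a2 : 0 < a ^+ 2 by rewrite exprn_even_gt0.
rewrite -(ler_pM2l a2) -subr_ge0.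
have ba1 : b <= a by apply: le_trans ba _; rewrite -[leRHS]mul1r ler_wpM2r.
have tba : tau * b <= a by apply: le_trans ba1; rewrite -[leRHS]mul1r ler_wpM2r.
have h1 : 0 <= (tau ^+ 2 * a ^+ 2 - b ^+ 2) * (a ^+ 2 - tau ^+ 2 * b ^+ 2).
  by apply: mulr_ge0; rewrite subr_ge0 -exprMn ler_pXn2r ?nnegrE ?mulr_ge0.
have h2 : 0 <= tau ^+ 2 * ((a * c) ^+ 2 - (b ^+ 2) ^+ 2).
  by rewrite mulr_ge0 ?exprn_ge0 // subr_ge0 ler_pXn2r ?nnegrE ?mulr_ge0 ?exprn_ge0.
rewrite (_ : _ - _ = (tau ^+ 2 * a ^+ 2 - b ^+ 2) * (a ^+ 2 - tau ^+ 2 * b ^+ 2)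
  + tau ^+ 2 * ((a * c) ^+ 2 - (b ^+ 2) ^+ 2)); last by ring.
exact: addr_ge0.
Qed.

(** The bound f(tau) for 2 H / (1 + H^2), without diagonalizing H: the norms a, b, c
    of y, H y and H^2 y satisfy b <= tau a, and b^2 = <y, H^2 y> <= a c. *)
Lemma hermitian_resolvent_le H y (tau : R) : adjmx H = H -> 0 <= tau -> tau <= 1 ->
  (forall v, l2norm (H *m v) <= tau * l2norm v) ->
  (1 + tau ^+ 2) * l2norm (H *m y) <= tau * l2norm (y + H *m (H *m y)).
Proof.
move=> Hsa tau0 tau1 Htau.
have yHHy : rip y (H *m (H *m y)) = l2norm (H *m y) ^+ 2.
  by rewrite sqr_l2norm rip_adj Hsa.
have dE : l2norm (y + H *m (H *m y)) ^+ 2 =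
    l2norm y ^+ 2 + 2 * l2norm (H *m y) ^+ 2 + l2norm (H *m (H *m y)) ^+ 2.
  rewrite sqr_l2norm !(ripDl, ripDr) (ripC _ y) yHHy -!sqr_l2norm.
  by move: (l2norm _) (l2norm _) (l2norm _) => a b c; ring.
have tt0 := sqr_ge0 tau.
rewrite -(@ler_pXn2r _ 2) // ?nnegrE ?mulr_ge0 ?l2norm_ge0 //; last by lra.
rewrite !exprMn dE; apply: real_resolvent_le => //; try exact: l2norm_ge0.
by rewrite -yHHy rip_le.
Qed.

End CayleyMatrix.

Section Cutoff.
Context {R : realType} {A : cstarAlgType R}.

(** The element is 2 h / (1 + h^2). The upper bound on its matrix norms is
    [hermitian_resolvent_le]; the lower bound follows from
    2 |H y| <= mu |y + H^2 y| <= mu (1 + tau^2) |y|, where mu and tau are the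
    matrix norms of the element and of h. *)
Lemma cutoff (h : A) : cadj h = h ->
  exists a : A, [/\ cadj a = a, nrm a <= 1 & forall m, mxnorm m h <= 1 ->
    mxnorm m a * (1 + mxnorm m h ^+ 2) = 2 * mxnorm m h].
Proof.
move=> hsa; have [w [wE w1]] := cayley_imaginary_part hsa.
exists (- 'i *: (w - cadj w)); split.
- rewrite cadj_scale cadjB cadjK -opprB scalerN -scaleNr; congr (_ *: _).
  by apply/eqP; rewrite eq_complex /= !oppr0 opprK !eqxx.
- by rewrite scaleNr nrmN nrmZi.
move=> m tau1.
pose a := - 'i *: (w - cadj w).
have tau0 := mxnorm_ge0 (n := m) h; have mu0 := mxnorm_ge0 (n := m) a.
have tau_ub := fun pi => @l2norm_le_mxnorm _ _ m pi h.
have mu_ub := fun pi => @l2norm_le_mxnorm _ _ m pi a.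
have tau_le := fun c => @mxnorm_le _ _ m h c.
have mu_le := fun c => @mxnorm_le _ _ m a c.
rewrite -/a; move: (mxnorm m h) (mxnorm m a) tau0 tau1 mu0 tau_ub mu_ub tau_le mu_le.
move=> tau mu tau0 tau1 mu0 tau_ub mu_ub tau_le mu_le.
have den : 0 < 1 + tau ^+ 2 by rewrite ltr_pwDl // sqr_ge0.
have repE (pi : A -> 'M[R[i]]_m) : star_hom pi ->
   [/\ adjmx (pi h) = pi h,
   pi (- 'i *: (w - cadj w)) *m (1%:M + pi h *m pi h) = pi h + pi h &
  exists G, (1%:M + pi h *m pi h) *m G = 1%:M].
  move=> piH; have pisa : adjmx (pi h) = pi h by rewrite -(star_hom_adj piH) hsa.
  have [||aE GE] := @cayley_mx_imaginary _ _ (pi h) (pi w) => //.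
    by rewrite {1}wE star_homD // !star_homZ // (star_homM piH).
  by split=> //; rewrite star_homZ // star_homB // (star_hom_adj piH).
have half_l2 (v : 'cV[R[i]]_m) : l2norm (v + v) = 2 * l2norm v.
  by rewrite -mulr2n -scaler_nat -(rmorph_nat (real_complex R)) l2normZ ger0_norm.
apply/eqP; rewrite eq_le; apply/andP; split.
- rewrite -ler_pdivlMr //; apply: mu_le => [|pi piH v].
    by apply: divr_ge0; [exact: mulr_ge0|exact: ltW].
  have [pisa aE [G GE]] := repE pi piH.
  have -> : v = (1%:M + pi h *m pi h) *m (G *m v) by rewrite mulmxA GE mul1mx.
  move: (G *m v) => y; rewrite mulmxA aE mulmxDl mulmxDl mul1mx -mulmxA half_l2.
  have := hermitian_resolvent_le y pisa tau0 tau1 (tau_ub pi piH).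
  move: (l2norm _) (l2norm _) => p q pq.
  by rewrite mulrAC ler_pdivlMr //; lra.
- rewrite mulrC -ler_pdivlMr //; apply: tau_le => [|pi piH y].
    by apply: divr_ge0 => //; apply: mulr_ge0 => //; exact: ltW.
  have [pisa aE _] := repE pi piH.
  have := mu_ub pi piH ((1%:M + pi h *m pi h) *m y).
  rewrite mulmxA aE !mulmxDl half_l2 mul1mx -mulmxA => ay.
  have := l2normD y (pi h *m (pi h *m y)).
  have := tau_ub pi piH y; have := tau_ub pi piH (pi h *m y).
  move: ay; have := l2norm_ge0 y.
  move: (l2norm y) (l2norm (pi h *m y)) => p q.
  move: (l2norm (y + _)) => r; move: (l2norm _) => s p0 ay sq qp rps.
  rewrite mulrAC ler_pdivlMr //; apply: le_trans (_ : mu * r <= _); first by lra.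
  rewrite -mulrA; apply: ler_wpM2l => //.
  have : tau * q <= tau * (tau * p) by exact: ler_wpM2l.
  by rewrite expr2; lra.
Qed.

End Cutoff.

(** * The image of an irreducible representation *)

(** A subspace of maximal dimension among those inside P. *)
Lemma subspace_of_pred (F : fieldType) (V : vectType F) (P : V -> Prop) :
  P 0 -> (forall (k : F) u v, P u -> P v -> P (k *: u + v)) ->
  exists U : {vspace V}, forall v, v \in U <-> P v.
Proof.
move=> P0 PD.
pose Q k := `[< exists2 U : {vspace V}, \dim U = k & forall v, v \in U -> P v >].
have Qex : exists k, Q k.
  by exists 0%N; apply/asboolP; exists 0%VS; rewrite ?dimv0 // => v; rewrite memv0 => /eqP->.
have Qub k : Q k -> (k <= \dim {:V})%N.
  by move=> /asboolP[U <- _]; apply: dimvS; exact: subvf.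
case: (ex_maxnP Qex Qub) => k /asboolP[U Uk UP] kmax.
exists U => v; split=> [|Pv]; first exact: UP.
apply/negPn/negP => vU.
have : (\dim (U + <[v]>)%VS <= k)%N.
  apply: kmax; apply/asboolP; exists (U + <[v]>)%VS => // _ /memv_addP[u uU [_ /vlineP[c ->] ->]].
  by rewrite addrC; apply: PD => //; exact: UP.
rewrite -Uk leqNgt => /negP; apply.
rewrite (ltn_leqif (dimv_leqif_sup (addvSl _ _))).
by apply: contra vU => /subvP; apply; exact: (subvP (addvSr _ _)) (memv_line _).
Qed.

Section Irreducible.
Context {R : realType} {A : cstarAlgType R}.
Variables (n : nat) (pi : A -> 'M[R[i]]_n).
Hypothesis piI : irr_rep pi.
Let piH : star_hom pi := irr_rep_star_hom piI.

(** The orbit of v and the annihilator of the image of pi are invariant subspaces;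
    the latter is zero because pi is not, so the former is not zero. *)
Lemma irr_rep_cyclic (v w : 'cV[R[i]]_n) : v != 0 -> exists a, pi a *m v = w.
Proof.
move=> v0.
have [||U UE] := @subspace_of_pred _ 'cV[R[i]]_n (fun x => exists a, pi a *m v = x).
- by exists 0; rewrite star_hom0 // mul0mx.
- move=> k _ _ [a <-] [b <-]; exists (k *: a + b).
  by rewrite star_homD // star_homZ // mulmxDl scalemxAl.
have [a x /UE[b <-]|U0|Uf] := irr_rep_invariant piI (U := U).
- by apply/UE; exists (a ** b); rewrite (star_homM piH) mulmxA.
- have piv a : pi a *m v = 0 by apply/eqP; rewrite -memv0 -U0; apply/UE; exists a.
  have [||W WE] := @subspace_of_pred _ 'cV[R[i]]_n (fun x => forall a, pi a *m x = 0).
  + by move=> a; rewrite mulmx0.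
  + by move=> k x y x0 y0 a; rewrite mulmxDr -scalemxAr x0 y0 scaler0 addr0.
  have [a x /WE ->|W0|Wf] := irr_rep_invariant piI (U := W).
  + by apply: mem0v.
  + by have /WE := piv; rewrite W0 memv0 (negPf v0).
  + have [a /eqP[]] := irr_rep_neq0 piI.
    apply/matrixP => i j; rewrite mxE.
    have /WE /(_ a) /matrixP /(_ i 0) : delta_mx j 0 \in W by rewrite Wf memvf.
    by rewrite -colE !mxE.
- by apply/UE; rewrite Uf memvf.
Qed.

(** A nonzero matrix T of minimal rank in the image has rank one. Given y, fix x with T x != 0
    and choose S in the image with S T x = y; the compression of S to the range of T has an
    eigenvalue c, so T S T - c T has smaller rank than T, hence vanishes and
    T y = c T x. *)
Lemma irr_rep_rank1 : exists a u (c : 'rV[R[i]]_n),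
  [/\ pi a = u *m c, u != 0 & c != 0].
Proof.
pose Q k := `[< exists2 a, pi a != 0 & \rank (pi a) = k >].
have Qex : exists k, Q k.
  by have [a a0] := irr_rep_neq0 piI; exists (\rank (pi a)); apply/asboolP; exists a.
case: (ex_minnP Qex) => r /asboolP[t t0 tr] rmin.
have r0 : (0 < r)%N by rewrite -tr lt0n mxrank_eq0.
have [x tx0] : exists x : 'cV[R[i]]_n, pi t *m x != 0.
  apply/not_existsP => tx; case/eqP: t0; apply/matrixP => i j.
  have /negP/negPn/eqP/matrixP/(_ i 0) := tx (delta_mx j 0).
  by rewrite -colE !mxE.
have t_line y : exists c : R[i], pi t *m y = c *: (pi t *m x).
  have [s sE] := irr_rep_cyclic y tx0.
  pose L := col_base (pi t); pose B := row_base (pi t).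
  have LB : L *m B = pi t by exact: mulmx_base.
  (* B S L is the compression of S to the range of T = L B, of size rank T. *)
  have [|c /eigenvalueP[v vN v0]] := eigenvalue_closed (B *m pi s *m L).
    by rewrite tr.
  exists c.
  have E : pi (t ** (s ** t) - c *: t) = L *m (B *m pi s *m L - c%:M) *m B.
    rewrite star_homB // star_homZ // !(star_homM piH) mulmxBr mulmxBl.
    by rewrite mul_mx_scalar -scalemxAl LB -{1 2}LB !mulmxA.
  have : pi (t ** (s ** t) - c *: t) = 0.
    apply/eqP/negPn/negP => E0.
    have : (r <= \rank (pi (t ** (s ** t) - c *: t)%R))%N.
      by apply: rmin; apply/asboolP; exists (t ** (s ** t) - c *: t).
    rewrite E leqNgt => /negP; apply.
    apply: leq_ltn_trans (mxrankM_maxl _ _) _.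
    apply: leq_ltn_trans (mxrankM_maxr _ _) _.
    rewrite -[ltnRHS]tr ltnNge; apply/negP => full.
    case/eqP: v0; apply: (@row_free_inj _ _ _ _ (B *m pi s *m L - c%:M)).
      by rewrite /row_free eqn_leq rank_leq_row.
    by rewrite mul0mx mulmxBr vN mul_mx_scalar subrr.
  rewrite star_homB // star_homZ // !(star_homM piH) => /eqP.
  rewrite subr_eq0 => /eqP tst.
  by rewrite -sE !mulmxA -[_ *m pi s *m _]mulmxA tst scalemxAl.
have [c cE] := boolp.choice (fun j : 'I_n => t_line (delta_mx j 0)).
have tE : pi t = (pi t *m x) *m \row_j c j.
  apply/matrixP => i j; have /matrixP/(_ i 0) := cE j.
  by rewrite -colE !mxE big_ord1 !mxE mulrC.
exists t, (pi t *m x), (\row_j c j); split=> //.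
by apply: contra t0 => /eqP c0; rewrite tE c0 mulmx0.
Qed.

(** The image contains some u c^T and, by cyclicity, moves u to any vector; since it is
    closed under adjoints, it moves c to any row as well. *)
Lemma irr_rep_onto_rank1 (w z : 'cV[R[i]]_n) : exists a, pi a = w *m hconj z.
Proof.
have [t [u [c [tE u0 c0]]]] := irr_rep_rank1.
have hc0 : hconj c != 0.
  by apply: contra c0 => /eqP hc; rewrite -[c]hconjK hc /hconj map_mx0 trmx0.
have [a aE] := irr_rep_cyclic w u0; have [b bE] := irr_rep_cyclic z hc0.
exists (a ** (t ** cadj b)).
rewrite !(star_homM piH) (star_hom_adj piH) tE -[adjmx _]/(hconj _).
by rewrite -aE -bE hconjM hconjK !mulmxA.
Qed.

Lemma irr_rep_delta (i j : 'I_n) : exists a, pi a = delta_mx i j.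
Proof.
have [a aE] := irr_rep_onto_rank1 (delta_mx i 0) (delta_mx j 0).
exists a; rewrite aE; apply/matrixP => k l; rewrite !mxE big_ord1 !mxE.
by rewrite !eqxx !andbT rmorph_nat -natrM mulnb.
Qed.

End Irreducible.

(** * Elements killed by representations of small dimension *)

Fixpoint mprod (F : pzRingType) m (M : nat -> 'M[F]_m) k : 'M[F]_m :=
  if k is k'.+1 then mprod M k' *m M k else M 0%N.

(** Products of k + 1 factors, by recursion from a first factor because A need
    not have a unit to start from. *)
Fixpoint cprod (R : realType) (A : cstarAlgType R) (f : nat -> A) k : A :=
  if k is k'.+1 then cprod f k' ** f k else f 0%N.

(** This reduces alternating sums of matrix products to determinants: the paths c do
    not depend on M, so a sum over permutations of the factors can be taken
    inside the sum over paths, where the products are commutative. *)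
Lemma mprod_paths (F : pzRingType) m k (a b : 'I_m) :
  exists L : seq (nat -> 'I_m * 'I_m), forall M : nat -> 'M[F]_m,
    mprod M k a b = \sum_(c <- L) \prod_(p < k.+1) M p (c p).1 (c p).2.
Proof.
elim: k b => [|k IH] b.
  by exists [:: fun=> (a, b)] => M; rewrite big_seq1 big_ord1.
have [L LE] := boolp.choice IH.
pose ext j (c : nat -> 'I_m * 'I_m) p := if p == k.+1 then (j, b) else c p.
exists [seq ext j c | j <- enum 'I_m, c <- L j] => M.
rewrite big_allpairs_dep big_enum /= mxE; apply: eq_bigr => j _.
rewrite LE mulr_suml; apply: eq_bigr => c _.
rewrite [RHS]big_ord_recr /= /ext eqxx; congr (_ * _).
by apply: eq_bigr => p _; rewrite /= ltn_eqF.
Qed.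

Lemma mprod_scale (F : comPzRingType) m (c : nat -> F) (E : 'M[F]_m) k :
  E *m E = E -> mprod (fun p => c p *: E) k = (\prod_(p < k.+1) c p) *: E.
Proof.
move=> EE; elim: k => [|k IH]; first by rewrite big_ord1.
by rewrite big_ord_recr /= IH -scalemxAl -scalemxAr EE scalerA.
Qed.

Section Capelli.
Context {R : realType} {A : cstarAlgType R}.

(** The Capelli polynomial, alternating in the z's, with coefficients u p and w p
    between consecutive z's. *)
Definition capelli k (u w : nat -> A) (z : 'I_k.+1 -> A) : A :=
  \sum_(s : 'S_k.+1) ((-1) ^+ s : R[i]) *:
    cprod (fun p => u p ** z (s (inord p)) ** w p) k.

Lemma star_hom_sum m (rho : A -> 'M[R[i]]_m) I (r : seq I) (P : pred I) (f : I -> A) :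
  star_hom rho -> rho (\sum_(i <- r | P i) f i) = \sum_(i <- r | P i) rho (f i).
Proof. by move=> rhoH; apply: (big_morph rho (star_homD rhoH) (star_hom0 rhoH)). Qed.

Lemma star_hom_cprod m (rho : A -> 'M[R[i]]_m) f k :
  star_hom rho -> rho (cprod f k) = mprod (rho \o f) k.
Proof. by move=> rhoH; elim: k => //= k <-; rewrite (star_homM rhoH). Qed.

(** More than m^2 matrices of size m are linearly dependent. Expanded along paths, each
    entry of the image is a sum of determinants whose columns satisfy that
    same dependence relation. *)
Lemma capelli_vanish m (rho : A -> 'M[R[i]]_m) k u w (z : 'I_k.+1 -> A) :
  star_hom rho -> (m * m < k.+1)%N -> rho (capelli u w z) = 0.
Proof.
move=> rhoH mk.
have [c c0 cz] : exists2 c : 'rV[R[i]]_k.+1, c != 0 & \sum_q c 0 q *: rho (z q) = 0.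
  pose Z := \matrix_q mxvec (rho (z q)).
  have : kermx Z != 0.
    rewrite -mxrank_eq0 mxrank_ker subn_eq0 -ltnNge.
    exact: leq_ltn_trans (rank_leq_col _) mk.
  move=> /rowV0Pn[c cker c0]; exists c => //.
  apply: (can_inj mxvecK); rewrite linear0 linear_sum /=.
  move: cker; rewrite sub_kermx => /eqP; rewrite mulmx_sum_row => cZ.
  by rewrite -[RHS]cZ; apply: eq_bigr => q _; rewrite linearZ rowK.
apply/matrixP => a b; rewrite star_hom_sum // summxE mxE.
have [L LE] := mprod_paths R[i] k a b.
pose G (d : nat -> 'I_m * 'I_m) := \matrix_(p < k.+1, q < k.+1)
  (rho (u p) *m rho (z q) *m rho (w p)) (d p).1 (d p).2.
transitivity (\sum_(d <- L) \det (G d)).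
  rewrite /determinant exchange_big /=; apply: eq_bigr => s _.
  rewrite star_homZ // star_hom_cprod // mxE LE mulr_sumr; apply: eq_bigr => d _.
  congr (_ * _); apply: eq_bigr => p _.
  by rewrite /= mxE inord_val !(star_homM rhoH).
apply: big1 => d _; apply/eqP; rewrite -det_tr; apply/det0P; exists c => //.
apply/rowP => p; rewrite mxE [RHS]mxE.
transitivity ((rho (u p) *m (\sum_q c 0 q *: rho (z q)) *m rho (w p)) (d p).1 (d p).2).
  rewrite mulmx_sumr mulmx_suml summxE; apply: eq_bigr => q _.
  by rewrite -scalemxAr -scalemxAl !mxE.
by rewrite cz mulmx0 mul0mx mxE.
Qed.

(** Take for the z's lifts of all the matrix units E_ij, and surround the slot of (i, j)
    by E_0i and E_j0. The image of this slot is E_00 when it receives E_ij and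
    0 otherwise, so only the identity permutation contributes and the image of
    the Capelli polynomial is E_00. *)
Lemma irr_rep_separating n (pi : A -> 'M[R[i]]_n) : irr_rep pi ->
  exists2 b : A, pi b != 0 & forall m (rho : A -> 'M[R[i]]_m),
    (m < n)%N -> star_hom rho -> rho b = 0.
Proof.
move=> piI; have piH := irr_rep_star_hom piI.
case: n pi piI piH => [|n] pi piI piH.
  by have [a /eqP[]] := irr_rep_neq0 piI; apply/matrixP => -[].
have [l lE] := boolp.choice (fun ij : 'I_n.+1 * 'I_n.+1 => irr_rep_delta piI ij.1 ij.2).
pose k := (n.+1 * n.+1).-1.
have kE : k.+1 = (n.+1 * n.+1)%N by [].
pose idx (q : 'I_k.+1) := nth (ord0, ord0) (enum {: 'I_n.+1 * 'I_n.+1}) q.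
have idx_inj : injective idx.
  move=> p q /eqP; rewrite nth_uniq ?enum_uniq -?cardE ?card_prod ?card_ord -?kE //.
  by move/eqP/val_inj.
(* idx p is the pair of indices of the matrix unit that belongs in slot p. *)
pose u (p : nat) := l (ord0, (idx (inord p)).1).
pose w (p : nat) := l ((idx (inord p)).2, ord0).
exists (capelli u w (l \o idx)); last first.
  move=> m rho mn rhoH; apply: capelli_vanish => //.
  by rewrite kE; exact: ltn_mul.
pose E : 'M[R[i]]_n.+1 := delta_mx ord0 ord0.
have EE : E *m E = E by rewrite mul_delta_mx.
suff -> : pi (capelli u w (l \o idx)) = E.
  by apply/eqP => /matrixP /(_ ord0 ord0) /eqP; rewrite !mxE eqxx oner_eq0.
rewrite star_hom_sum //.
(* The scalar in front of E is the Leibniz expansion of the identity matrix. *)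
transitivity (\det (1%:M : 'M[R[i]]_k.+1) *: E); last by rewrite det1 scale1r.
rewrite /determinant scaler_suml; apply: eq_bigr => s _.
rewrite star_homZ // star_hom_cprod // -scalerA; congr (_ *: _).
pose c p : R[i] := (inord p == s (inord p))%:R.
rewrite (_ : _ \o _ = fun p => c p *: E).
  rewrite mprod_scale //; congr (_ *: _); apply: eq_bigr => p _.
  by rewrite /c inord_val mxE.
apply/funext => p /=; rewrite !(star_homM piH) !lE /= /c.
set q := inord p; have [sq|sq] := eqVneq q (s q).
  by rewrite -sq !mul_delta_mx scale1r.
rewrite scale0r.
have : idx q != idx (s q) by rewrite (inj_eq idx_inj).
rewrite -pair_eqE /= negb_and => /orP[ne|ne].
  by rewrite mul_delta_mx_0 // mul0mx.
by rewrite -mulmxA [X in _ *m X]mul_delta_mx_0 ?mulmx0 // eq_sym.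
Qed.

End Capelli.

(** * Prescribing matrix norms *)

Section CutoffInverse.
Context {R : realType}.

(** The inverse of t |-> 2 t / (1 + t^2) on [0, 1]. *)
Definition cutoff_inv (y : R) : R := y / (1 + Num.sqrt (1 - y ^+ 2)).

Lemma cutoff_invE y : 0 <= y -> y <= 1 ->
  2 * cutoff_inv y = y * (1 + cutoff_inv y ^+ 2).
Proof.
move=> y0 y1; rewrite /cutoff_inv; have := sqrtr_ge0 (1 - y ^+ 2).
have : Num.sqrt (1 - y ^+ 2) ^+ 2 = 1 - y ^+ 2 by rewrite sqr_sqrtr //; nra.
move: (Num.sqrt _) => s s2 s0.
have s1 : 1 + s != 0 by apply: lt0r_neq0; lra.
apply: (mulIf (expf_neq0 2 s1)).
have -> : y * (1 + (y / (1 + s)) ^+ 2) * (1 + s) ^+ 2 = y * ((1 + s) ^+ 2 + y ^+ 2).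
  by field.
have -> : 2 * (y / (1 + s)) * (1 + s) ^+ 2 = y * (2 * (1 + s)) by field.
by congr (_ * _); have -> : y ^+ 2 = 1 - s ^+ 2; [lra|ring].
Qed.

Lemma cutoff_inv_ge0 y : 0 <= y -> 0 <= cutoff_inv y.
Proof. by move=> y0; rewrite divr_ge0 // addr_ge0 // sqrtr_ge0. Qed.

Lemma le_cutoff_inv y z : 0 <= y -> y <= z -> z <= 1 -> cutoff_inv y <= cutoff_inv z.
Proof.
move=> y0 yz z1; have z0 := le_trans y0 yz.
have s0 := sqrtr_ge0 (1 - z ^+ 2).
have st : Num.sqrt (1 - z ^+ 2) <= Num.sqrt (1 - y ^+ 2).
  by rewrite ler_wsqrtr // lerD2l lerN2 lerXn2r // nnegrE.
apply: ler_pM => //; rewrite ?invr_ge0 ?lef_pV2 ?posrE; lra.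
Qed.

Lemma cutoff_inv1 : cutoff_inv 1 = 1.
Proof. by rewrite /cutoff_inv expr1n subrr sqrtr0 addr0 divr1. Qed.

Lemma cutoff_inv_le1 y : 0 <= y -> y <= 1 -> cutoff_inv y <= 1.
Proof. by move=> y0 y1; rewrite -[leRHS]cutoff_inv1 le_cutoff_inv. Qed.

End CutoffInverse.

Section Prescribed.
Context {R : realType} {A : cstarAlgType R}.

Lemma mxnorm_gt0 n (pi : A -> 'M[R[i]]_n) a : star_hom pi -> pi a != 0 ->
  0 < mxnorm n a.
Proof.
move=> piH pa; rewrite lt_def mxnorm_ge0 andbT; apply: contra pa => /eqP a0.
apply/eqP/matrixP => i j; rewrite mxE.
have : pi a *m delta_mx j 0 = 0 :> 'cV_n.
  apply: l2norm_eq0; apply/eqP; rewrite eq_le l2norm_ge0 andbT.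
  by apply: le_trans (l2norm_le_mxnorm a piH _) _; rewrite a0 mul0r.
by move/matrixP/(_ i 0); rewrite -colE !mxE.
Qed.

Lemma adjM_neq0 n (pi : A -> 'M[R[i]]_n) b : star_hom pi -> pi b != 0 ->
  pi (cadj b ** b) != 0.
Proof.
move=> piH; apply: contra => /eqP bb0; apply/eqP/matrixP => i j; rewrite mxE.
have : pi b *m delta_mx j 0 = 0 :> 'cV_n.
  apply: l2norm_eq0; apply/eqP; rewrite -sqrf_eq0 sqr_l2norm star_hom_rip //.
  by rewrite mulmxA -(star_homM piH) bb0 mul0mx /rip mulmx0 mxE.
by move/matrixP/(_ i 0); rewrite -colE !mxE.
Qed.

(** In c, this function is Lipschitz with constant nrm b. *)
Lemma mxnorm_line_continuous n (x b : A) :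
  continuous (fun c : R => mxnorm n (x + c%:C *: b)).
Proof.
have lip (s t : R) : mxnorm n (x + s%:C *: b) <= mxnorm n (x + t%:C *: b) + `|s - t| * nrm b.
  have -> : x + s%:C *: b = (x + t%:C *: b) + (s - t)%:C *: b.
    by rewrite -addrA -real_scaleD addrC (addrC t) subrK addrC.
  apply: le_trans (mxnormD _ _) _; rewrite lerD2l.
  by apply: le_trans (mxnorm_le_nrm _) _; rewrite nrmZR.
have b0 := nrm_ge0 b.
move=> s; apply/cvgrPdist_lt => e e0.
have d0 : 0 < e / (nrm b + 1) by apply: divr_gt0 => //; lra.
near=> t.
have st : `|s - t| < e / (nrm b + 1).
  by near: t; exact: (@cvgr_dist_lt _ _ _ (nbhs s) _ id s (@cvg_id _ _) _ d0).
have st' : `|s - t| * nrm b < e.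
  move: st; rewrite ltr_pdivlMr; last by lra.
  by have := normr_ge0 (s - t); nra.
have := lip s t; have := lip t s; rewrite distrC.
move: (mxnorm _ _) (mxnorm _ _) => p q qp pq.
by rewrite ltr_norml; apply/andP; split; lra.
Unshelve. all: end_near. Qed.

(** At c = 0 the norm is at most nrm x <= 1; at c = 2 / mxnorm n b it is at least
    2 - nrm x >= 1. *)
Lemma mxnorm_line_eq1 n (x b : A) : nrm x <= 1 -> 0 < mxnorm n b ->
  exists c : R, mxnorm n (x + c%:C *: b) = 1.
Proof.
move=> x1 b0; pose g (c : R) := mxnorm n (x + c%:C *: b).
have g0 : g 0 <= 1.
  by rewrite /g scale0r addr0; apply: le_trans (mxnorm_le_nrm _) x1.
pose C := 2 / mxnorm n b.
have C0 : 0 < C by apply: divr_gt0.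
have gC : 1 <= g C.
  have Cb : mxnorm n (C%:C *: b) = 2 by rewrite (mxnormZ _ C0) /C divfK ?gt_eqF.
  have := mxnormD (n := n) (x + C%:C *: b) (- x).
  rewrite addrAC subrr add0r Cb.
  have := mxnorm_le_nrm (n := n) (- x); rewrite nrmN.
  rewrite /g; move: x1 (mxnorm _ (- x)) (mxnorm _ (_ + _)); move: (nrm x).
  by clear => r r1 p q; lra.
have gcont : continuous g by exact: mxnorm_line_continuous.
suff [c _ gc] : exists2 c, c \in `[0, C] & g c = 1 by exists c.
move: (ltW C0) g0 gC gcont; move: g C {C0} => g C C0 g0 gC gcont.
apply: IVT => //; first exact: continuous_subspaceT.
by rewrite ge_min le_max g0 gC orbT.
Qed.

(** Controlling nrm h along with the matrix norms is what makes the induction work: it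
    keeps the norm of x in the new dimension below the value prescribed
    there, whatever representations x meets in that dimension. *)
Lemma mxnorms_prescribed k (n : nat -> nat) (mu : nat -> R) (M : R) :
  (forall i j, (1 <= i)%N -> (i < j)%N -> (j <= k)%N -> (n i < n j)%N) ->
  (forall j, (1 <= j <= k)%N -> has_irr_rep A (n j)) ->
  0 <= M -> (forall j, (1 <= j <= k)%N -> 0 <= mu j <= M) ->
  (forall i j, (1 <= i)%N -> (i <= j)%N -> (j <= k)%N -> mu i <= mu j) ->
  exists h : A, [/\ cadj h = h, nrm h <= M &
    forall j, (1 <= j <= k)%N -> mxnorm (n j) h = mu j].
Proof.
elim: k mu M => [|k IH] mu M nlt irr M0 muM mule.
  exists 0; split=> [||[]//]; [exact: cadj0|by rewrite nrm0].
have /andP[m0 mM] := muM k.+1 (leqnn _).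
have [mz|mnz] := eqVneq (mu k.+1) 0.
  exists 0; split=> [||j /andP[j1 jk]]; [exact: cadj0|by rewrite nrm0|].
  rewrite mxnorm0; apply/eqP; rewrite eq_le -[X in _ && (_ <= X)]mz mule //.
  by have /andP[-> _] := muM j (introT andP (conj j1 jk)).
have mgt : 0 < mu k.+1 by rewrite lt_def mnz.
pose y j := mu j / mu k.+1.
have y0 j : (1 <= j <= k.+1)%N -> 0 <= y j.
  by move=> /muM/andP[? _]; rewrite divr_ge0.
have y1 j : (1 <= j <= k.+1)%N -> y j <= 1.
  by move=> /andP[j1 jk]; rewrite ler_pdivrMr // mul1r mule.
have widen j : (1 <= j <= k)%N -> (1 <= j <= k.+1)%N.
  by move=> /andP[-> /leqW].
have [|||i j i1 ij jk|x [xsa x1 xn]] :=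
  IH (fun j => cutoff_inv (y j)) 1 _ _ ler01 _ _.
- by move=> i j i1 ij jk; apply: nlt => //; exact: leqW.
- by move=> j /widen; exact: irr.
- by move=> j /widen jk; rewrite cutoff_inv_ge0 ?cutoff_inv_le1 ?y0 ?y1.
- apply: le_cutoff_inv.
  + by apply: y0; rewrite i1 (leq_trans ij) // leqW.
  + by rewrite ler_pM2r ?invr_gt0 // mule // leqW.
  + by apply: y1; rewrite (leq_trans i1 ij) leqW.
have [pi piI] := irr k.+1 (leqnn _).
have piH := irr_rep_star_hom piI.
have [b pb bz] := irr_rep_separating piI.
have [c cE] := mxnorm_line_eq1 x1 (mxnorm_gt0 piH (adjM_neq0 piH pb)).
set h := x + _ in cE.
have hsa : cadj h = h by rewrite /h cadjD cadjZR cadjM cadjK xsa.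
have [a [asa a1 aE]] := cutoff hsa.
exists ((mu k.+1)%:C *: a); split.
- by rewrite cadjZR asa.
- by rewrite nrmZR ger0_norm //; apply: le_trans mM; rewrite -[leRHS]mulr1 ler_wpM2l.
move=> j /andP[j1]; rewrite leq_eqVlt => /predU1P[->|jk].
  rewrite mxnormZ //; have := aE (n k.+1); rewrite cE lexx expr1n => /(_ isT).
  move: (mxnorm _ a) => p p2.
  have -> : p = 1 by clear -p2; lra.
  exact: mulr1.
have jk' : (1 <= j <= k)%N by rewrite j1.
(* In a dimension n j < n k.+1 the separating element vanishes, so x + c b acts as x. *)
have hj : mxnorm (n j) h = cutoff_inv (y j).
  rewrite -(xn _ jk'); apply: eq_mxnorm => rho rhoH.
  rewrite /h (star_homD rhoH) (star_homZ rhoH) (star_homM rhoH).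
  by rewrite (bz _ _ (nlt _ _ j1 jk (leqnn _)) rhoH) mulmx0 scaler0 addr0.
have := aE (n j); rewrite hj => /(_ (cutoff_inv_le1 (y0 j (widen j jk')) (y1 j (widen j jk')))).
rewrite cutoff_invE ?y0 ?y1 ?widen // => /mulIf aj.
rewrite mxnormZ // aj; first by rewrite /y mulrCA mulfV ?mulr1.
by rewrite gt_eqF // ltr_pwDl // sqr_ge0.
Qed.

End Prescribed.

Theorem theorem5p1 (R : realType) (A : cstarAlgType R) (N : nat)
    (lambda : nat -> R) (n : nat -> nat) :
  (1 <= N)%N ->
  0 <= lambda 1%N ->
  (forall i j : nat, (1 <= i)%N -> (i <= j)%N -> (j <= N)%N ->
     lambda i <= lambda j) ->
  (forall i j : nat, (1 <= i)%N -> (i < j)%N -> (j <= N)%N ->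
     (n i < n j)%N) ->
  (forall k : nat, (1 <= k)%N -> (k <= N)%N -> has_irr_rep A (n k)) ->
  exists a : A,
    (forall k : nat, (1 <= k)%N -> (k <= N)%N -> mxnorm (n k) a = lambda k) /\
    `|a| = (mxnorm (n N) a)%:C.
Proof.
move=> N1 l0 lle nlt irr.
have lge0 j : (1 <= j)%N -> (j <= N)%N -> 0 <= lambda j.
  by move=> j1 jN; apply: le_trans l0 (lle _ _ _ j1 jN).
have [||||a [_ aN aE]] := @mxnorms_prescribed _ A N n lambda (lambda N) nlt.
- by move=> j /andP[]; exact: irr.
- exact: lge0.
- by move=> j /andP[j1 jN]; rewrite lge0 // lle.
- exact: lle.
exists a; split=> [k k1 kN|]; first by rewrite aE // k1.
rewrite norm_nrmE; congr _%:C; apply/eqP; rewrite eq_le mxnorm_le_nrm andbT.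
by rewrite aE // N1 leqnn.
Qed.
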